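(* Let $\ell\ge 2$ and let $\mathcal A=\mathcal A(\alpha)\subset\mathbb P^\ell$ be a hyperplane arrangement. Then $\mathcal A$ is formal if and only if $\mathcal A$ has no non-trivial weak perspective representations up to rank $3$. More generally, for $3\le k\le \ell+1$, $\mathcal A$ is $k$-generated if and only if $\mathcal A$ has no non-trivial weak perspective representations up to rank $k$.
   Context: $\mathbb K$ is a field of characteristic zero, $V=\mathbb K^{\ell+1}$, $\mathbb P^\ell=\mathbb P(V)$. A hyperplane arrangement $\mathcal A=\mathcal A(\alpha)$ is given by a map $\alpha:\{1,\dots,n\}\to V^*$, $i\mapsto\alpha_i$, whose values are nonzero linear forms defining pairwise distinct hyperplanes $H_i=\mathbb V(\alpha_i)\subset\mathbb P^\ell$. $M(\alpha)$ is the $(\ell+1)\times n$ matrix whose columns are the coefficient vectors of the $\alpha_i$, and $\mathcal M(\alpha)$ is the linear matroid on $\{1,\dots,n\}$ of its columns. A flat is identified with the linear subspace of $\mathbb P^\ell$ that is the intersection of its hyperplanes; its rank is its codimension (the empty subspace has codimension $\ell+1$). The relation space is $\mathcal R(\mathcal A)=\ker M(\alpha)\subset\mathbb K^n$; the length of a relation is its number of nonzero entries. $\mathcal A$ is formal if $\mathcal R(\mathcal A)$ is spanned by relations of length three; it is $k$-generated ($k\ge3$) if $\mathcal R(\mathcal A)$ is spanned by relations of length at most $k$. Truncation: $\mathcal N^{[k]}$ is the matroid whose independent sets are the independent sets of $\mathcal N$ of size at most $k$. Weak order: $\mathcal N\ge\mathcal M$ if every dependent set of $\mathcal N$ is dependent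 in $\mathcal M$. A map $\beta:\{1,\dots,n\}\to V^*$ is a weak representation of $\mathcal M(\alpha)$ up to rank $k$ if $\mathcal M(\alpha)^{[k]}\ge\mathcal M(\beta)^{[k]}$. A hyperplane $H_0=\mathbb V(\alpha_0)$ is in rank $k$ general linear position with respect to $\mathcal A$ if no nonempty flat of $\mathcal A$ of rank at most $k$ is contained in $H_0$. Fix such an $H_0$. Maps $\alpha,\beta$ are perspective from $H_0$ (with $H_0$ in neither arrangement) if $\mathbb V(\alpha_j)\cap H_0=\mathbb V(\beta_j)\cap H_0$ for all $j$; after rescaling each $\beta_j$ this means $\beta_j=\alpha_j+\lambda_j\alpha_0$ with $\lambda_j\in\mathbb K$. The space of weak perspective representations of $\mathcal A$ (from $H_0$) up to rank $k$ is the set of $\lambda\in\mathbb K^n$ such that $\beta_j=\alpha_j+\lambda_j\alpha_0$ is a weak representation of $\mathcal M(\alpha)$ up to rank $k$; for $3\le k\le \ell+1$ it is a linear subspace that does not depend on the choice of $H_0$. The trivial ones are those with $\lambda=(\alpha_1(\mathbf v),\dots,\alpha_n(\mathbf v))$ for some $\mathbf v\in\mathbb K^{\ell+1}$. The space of non-trivial weak perspective representations up to rank $k$ is the quotient of the former space by the subspace of trivial ones, and ''no non-trivial'' means that this quotient is zero. *)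

(* Defs.v *)
From HB Require Import structures.
From mathcomp Require Import all_boot all_order all_algebra.

Set Implicit Arguments.
Unset Strict Implicit.
Unset Printing Implicit Defensive.

Import GRing.Theory.
Local Open Scope ring_scope.

(* Conventions: [V = 'cV[K]_(l.+1)], and a linear form on [V] is the row vector
   [a] of its coefficients, acting by [v |-> a *m v].  A linear subspace of
   [P(V)] is encoded by the corresponding vector subspace of [V], so that the
   empty projective subspace is [0%VS] and codimensions agree. *)

(* A matroid on [T] is given by the set of its independent sets. *)
Section Matroids.

Variable T : finType.
Implicit Types (N M : {set {set T}}) (S : {set T}).

Definition truncation (k : nat) N : {set {set T}} :=
  [set S in N | (#|S| <= k)%N].

Definition weak_ge N M : Prop := forall S, S \notin N -> S \notin M.

Definition matroid_rank N S : nat := (\max_(I in N | I \subset S) #|I|)%N.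

Definition matroid_flat N S : Prop :=
  forall i, i \notin S -> (matroid_rank N S < matroid_rank N (i |: S))%N.

End Matroids.

Definition linear_matroid (K : fieldType) (m n : nat) (M : 'M[K]_(m, n)) :
    {set {set 'I_n}} :=
  [set S : {set 'I_n} | free [seq col j M | j in S]].

Definition spanned_by (K : fieldType) (vT : vectType K) (U : {vspace vT})
    (P : pred vT) : Prop :=
  forall u, u \in U <-> exists2 X : seq vT, all P X & u \in <<X>>%VS.

Section Arrangements.

Variables (K : fieldType) (l n : nat).
Implicit Types (alpha beta : 'I_n -> 'rV[K]_(l.+1)) (a : 'rV[K]_(l.+1)).

Definition hyperplane a : {vspace 'cV[K]_(l.+1)} :=
  lker (linfun (mulmx a : 'cV[K]_(l.+1) -> 'cV[K]_1)).

Definition arrangement alpha : Prop :=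
  (forall i, alpha i != 0) /\ injective (fun i => hyperplane (alpha i)).

Definition coef_mx alpha : 'M[K]_(l.+1, n) := \matrix_(i, j) alpha j 0 i.

Definition arr_matroid alpha : {set {set 'I_n}} :=
  linear_matroid (coef_mx alpha).

Definition flat_space alpha (S : {set 'I_n}) : {vspace 'cV[K]_(l.+1)} :=
  (\bigcap_(i in S) hyperplane (alpha i))%VS.

Definition codim (U : {vspace 'cV[K]_(l.+1)}) : nat := (l.+1 - \dim U)%N.

Definition relation_space alpha : {vspace 'cV[K]_n} :=
  lker (linfun (mulmx (coef_mx alpha) : 'cV[K]_n -> 'cV[K]_(l.+1))).

Definition rel_length (c : 'cV[K]_n) : nat := #|[set j | c j 0 != 0]|.

Definition formal alpha : Prop :=
  spanned_by (relation_space alpha)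
    [pred c | (c \in relation_space alpha) && (rel_length c == 3)].

Definition generated (k : nat) alpha : Prop :=
  spanned_by (relation_space alpha)
    [pred c | (c \in relation_space alpha) && (rel_length c <= k)%N].

Definition weak_representation (k : nat) alpha beta : Prop :=
  weak_ge (truncation k (arr_matroid alpha)) (truncation k (arr_matroid beta)).

Definition general_linear_position (k : nat) alpha a : Prop :=
  forall S : {set 'I_n}, matroid_flat (arr_matroid alpha) S ->
    flat_space alpha S != 0%VS -> (codim (flat_space alpha S) <= k)%N ->
    ~~ (flat_space alpha S <= hyperplane a)%VS.

Definition perspective alpha a (lam : 'cV[K]_n) : 'I_n -> 'rV[K]_(l.+1) :=
  fun j => alpha j + lam j 0 *: a.

Definition weak_perspective (k : nat) alpha a (lam : 'cV[K]_n) : Prop :=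
  weak_representation k alpha (perspective alpha a lam).

Definition trivial_perspective alpha (lam : 'cV[K]_n) : Prop :=
  exists v : 'cV[K]_(l.+1), lam = \col_j (alpha j *m v) 0 0.

(* Vanishing of the quotient of the space of weak perspective representations
   up to rank [k] by the subspace of trivial ones. *)
Definition no_nontrivial_weak_perspective (k : nat) alpha a : Prop :=
  forall lam, weak_perspective k alpha a lam -> trivial_perspective alpha lam.

End Arrangements.

(* Main.v *)
Require Import Defs.
From HB Require Import structures.
From mathcomp Require Import all_boot all_order all_algebra.

Set Implicit Arguments.
Unset Strict Implicit.
Unset Printing Implicit Defensive.

Import GRing.Theory.
Local Open Scope ring_scope.

(** For c in K^n with \sum_j c_j alpha_j = - (c . lam) alpha0 supported on a
    dependent set S with at most k elements, the flat of S is nonempty of rank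
    less than k, hence contains a point off H_0; evaluating there gives
    c . lam = 0, so c is a genuine relation.  Subtracting multiples of such
    relations, one shrinks the support of any relation of length at most k, and
    concludes that lam is a weak perspective representation up to rank k exactly
    when it is orthogonal to all relations of length at most k.  The trivial
    representations form the row space of M(alpha), which is the orthogonal
    complement of the whole relation space, so the statement is duality in
    K^n. *)

(** * Orthogonality and spans in coordinate space *)

Section LinearAlgebra.

Variable K : fieldType.

Lemma free_imageP (vT : vectType K) (I : finType) (f : I -> vT) (S : {set I}) :
  reflect (forall c : I -> K, \sum_(j in S) c j *: f j = 0 ->
             forall j, j \in S -> c j = 0)
    (free [seq f j | j in S]).
Proof.
apply: (iffP (@freeP _ _ _ (image_tuple f S))) => [freeS c|freeS d].
  rewrite big_enum_val => c0 j jS.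
  rewrite -(enum_rankK_in jS jS).
  apply: (freeS (fun i => c (enum_val i))).
  by rewrite -[RHS]c0; apply: eq_bigr => i _; rewrite nth_image.
move=> d0 i.
have iS := enum_valP i.
pose c j := d (enum_rank_in iS j).
have -> : d i = c (enum_val i) by rewrite /c enum_valK_in.
apply: freeS => //.
rewrite big_enum_val -[RHS]d0; apply: eq_bigr => j _.
by rewrite nth_image /c enum_valK_in.
Qed.

Lemma cV_neq0 (n : nat) (c : 'cV[K]_n) : c != 0 -> exists j, c j 0 != 0.
Proof.
move=> c0; apply/existsP; apply: contraNT c0 => /existsPn cN0.
by apply/eqP/colP=> j; rewrite mxE; apply/eqP; have := cN0 j; rewrite negbK.
Qed.

(** Let [B] have the members of [X] as rows. A row vector lies in the row space of [B] exactly when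
    [cokermx B] kills it, and the columns of [cokermx B] are orthogonal to [X], so it suffices to
    test [u] against them. *)
Lemma mem_span_dual (n : nat) (X : seq 'cV[K]_n) (u : 'cV[K]_n) :
  (forall lam : 'cV[K]_n, {in X, forall x, lam^T *m x = 0} -> lam^T *m u = 0) ->
  u \in <<X>>%VS.
Proof.
move=> Xu.
pose B := \matrix_(i < size X, j < n) X`_i j 0.
have rowB i : row i B = (X`_i)^T by apply/rowP=> j; rewrite !mxE.
have /submxP[D uD] : (u^T <= B)%MS.
  rewrite submxE; apply/eqP/trmx_inj; rewrite trmx_mul trmxK trmx0.
  apply/row_matrixP=> j; rewrite row_mul row0.
  have -> : row j (cokermx B)^T = (col j (cokermx B))^T by rewrite tr_col.
  apply: Xu => _ /(nthP 0)[i ltiX <-].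
  apply: trmx_inj; rewrite trmx_mul trmxK trmx0.
  by rewrite -(rowB (Ordinal ltiX)) -row_mul colE mulmxA mulmx_coker mul0mx row0.
rewrite -[u]trmxK uD mulmx_sum_row linear_sum /=.
apply: memv_suml => i _; rewrite linearZ /= rowB trmxK.
by apply/memvZ/memv_span/mem_nth.
Qed.

(** The same cokernel test applies, since the columns of [cokermx M] lie in the kernel of [M]. *)
Lemma row_space_dual (m n : nat) (M : 'M[K]_(m, n)) (lam : 'cV[K]_n) :
  (forall c : 'cV[K]_n, M *m c = 0 -> lam^T *m c = 0) ->
  exists v : 'cV[K]_m, lam = M^T *m v.
Proof.
move=> lamM; have /submxP[D lamD] : (lam^T <= M)%MS.
  rewrite submxE; apply/eqP/matrixP=> i j.
  have /lamM/matrixP/(_ i 0) : M *m col j (cokermx M) = 0.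
    by rewrite colE mulmxA mulmx_coker mul0mx.
  by rewrite colE mulmxA -colE !mxE.
by exists D^T; rewrite -trmx_mul -lamD trmxK.
Qed.

Lemma span_orthogonal (n : nat) (X : seq 'cV[K]_n) (lam u : 'cV[K]_n) :
  {in X, forall x, lam^T *m x = 0} -> u \in <<X>>%VS -> lam^T *m u = 0.
Proof.
move=> lamX /(@coord_span _ _ _ (in_tuple X)) ->.
rewrite mulmx_sumr big1 // => i _.
by rewrite -scalemxAr lamX ?scaler0 // mem_nth.
Qed.

End LinearAlgebra.

Lemma mem_truncation (T : finType) k (N : {set {set T}}) S :
  (S \in truncation k N) = (S \in N) && (#|S| <= k)%N.
Proof. by rewrite inE. Qed.

Section Arrangements.

Variables (K : fieldType) (l n : nat).
Implicit Types (alpha : 'I_n -> 'rV[K]_(l.+1)) (a : 'rV[K]_(l.+1)).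
Implicit Types (c lam : 'cV[K]_n) (S : {set 'I_n}).

(** * Relations, supports and dependent sets *)

Lemma mem_hyperplane a v : (v \in hyperplane a) = (a *m v == 0).
Proof. by rewrite memv_ker lfunE. Qed.

Lemma mem_relation alpha c :
  (c \in relation_space alpha) = (coef_mx alpha *m c == 0).
Proof. by rewrite memv_ker lfunE. Qed.

Lemma mem_relation_sum alpha c :
  (c \in relation_space alpha) = (\sum_j c j 0 *: alpha j == 0).
Proof.
rewrite mem_relation -(inj_eq trmx_inj) trmx0; congr (_ == _).
apply/rowP=> i; rewrite !mxE summxE; apply: eq_bigr => j _.
by rewrite !mxE mulrC.
Qed.

Lemma mem_flat_space alpha S v :
  reflect (forall i, i \in S -> alpha i *m v = 0) (v \in flat_space alpha S).
Proof.
rewrite memvE; apply: (iffP subv_bigcapP) => vS i /vS.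
  by rewrite -memvE mem_hyperplane => /eqP.
by move/eqP; rewrite -memvE mem_hyperplane.
Qed.

Definition supported c S := forall j, j \notin S -> c j 0 = 0.

Lemma sum_supported (vT : lmodType K) (f : 'I_n -> vT) c S :
  supported c S -> \sum_(j in S) c j 0 *: f j = \sum_j c j 0 *: f j.
Proof. by move=> cS; apply: big_rmcond => j /cS ->; rewrite scale0r. Qed.

(** The diagonal matrix projects onto the coordinates outside [S]. Writing the support condition as
    its kernel yields a vector space, from which a nonzero vector or a basis can be picked. *)
Definition relations_on alpha S : {vspace 'cV[K]_n} :=
  (relation_space alpha :&:
   lker (linfun (mulmx (diag_mx (\row_j (j \notin S)%:R)) :
                   'cV[K]_n -> 'cV[K]_n)))%VS.

Lemma relations_onP alpha S c :
  reflect (c \in relation_space alpha /\ supported c S)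
    (c \in relations_on alpha S).
Proof.
rewrite memv_cap memv_ker lfunE /= mul_diag_mx.
apply: (iffP andP) => -[cR cS]; split=> //.
  by move=> j jS; have /eqP/colP/(_ j) := cS; rewrite !mxE jS mul1r.
apply/eqP/colP=> j; rewrite !mxE.
by case: (boolP (j \in S)) => [_|/cS ->]; rewrite ?mul0r ?mulr0.
Qed.

Lemma arr_matroid_dependentP alpha S :
  reflect (exists c, [/\ c != 0, supported c S & c \in relation_space alpha])
    (S \notin arr_matroid alpha).
Proof.
have sumE (d : 'I_n -> K) :
    (\sum_(j in S) d j *: col j (coef_mx alpha))^T
    = \sum_(j in S) d j *: alpha j.
  rewrite linear_sum; apply: eq_bigr => j _.
  by apply/rowP=> i; rewrite !mxE.
rewrite inE; apply: (iffP idP) => [depS|[c [c0 cS cR]]].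
  (* Either a nonzero relation lives on [S], or every vanishing combination of the columns in [S],
     extended by zero, is trivial. *)
  case: (eqVneq (relations_on alpha S) 0%VS) => [R0|]; last first.
    rewrite -vpick0 => c0.
    have /relations_onP[cR cS] := memv_pick (relations_on alpha S).
    by exists (vpick (relations_on alpha S)).
  case/negP: depS; apply/free_imageP => d d0 j jS.
  pose c : 'cV[K]_n := \col_i (if i \in S then d i else 0).
  have cS : supported c S by move=> i iS; rewrite mxE (negbTE iS).
  suff : c \in relations_on alpha S.
    by rewrite R0 memv0 => /eqP/colP/(_ j); rewrite !mxE jS.
  apply/relations_onP; split=> //; rewrite mem_relation_sum.
  rewrite -(sum_supported alpha cS); apply/eqP.
  transitivity (\sum_(i in S) d i *: alpha i); last by rewrite -sumE d0 trmx0.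
  by apply: eq_bigr => i iS; rewrite mxE iS.
apply: contra c0 => /free_imageP freeS; apply/eqP/colP=> j; rewrite mxE.
case: (boolP (j \in S)) => [jS|/cS //].
apply: (freeS (fun j => c j 0)) jS; apply: trmx_inj.
rewrite sumE trmx0 (sum_supported alpha cS).
by apply/eqP; rewrite -mem_relation_sum.
Qed.

Lemma weak_representationP k alpha (beta : 'I_n -> 'rV[K]_(l.+1)) :
  weak_representation k alpha beta <->
  forall S, (#|S| <= k)%N -> S \notin arr_matroid alpha ->
    S \notin arr_matroid beta.
Proof.
split=> [wab S Sk depS | wab S].
  by have := wab S; rewrite !mem_truncation Sk !andbT; apply.
rewrite !mem_truncation; case: (boolP (#|S| <= k)%N) => Sk; rewrite ?andbF //.
by rewrite !andbT; apply: wab.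
Qed.

(** * Flats and general linear position *)

Lemma codim_flat_space alpha S : (codim (flat_space alpha S) <= #|S|)%N.
Proof.
rewrite leq_subLR -sum1_card /flat_space.
elim/big_rec2: _ => [|i U m _ dimm]; first by rewrite addn0 dimvf dim_matrix mulr1.
apply: leq_trans dimm _; rewrite addnA leq_add2r addn1 capvC.
rewrite /hyperplane; set f := linfun _.
(* A linear form has rank at most 1 on any subspace, so each hyperplane lowers the dimension by at
   most 1. *)
have imf : (\dim (f @: m) <= 1)%N.
  by apply: leq_trans (dimvS (subvf _)) _; rewrite dimvf dim_matrix.
by rewrite -(limg_ker_dim f m) -[leqRHS]addn1 leq_add2l.
Qed.

(** General linear position speaks of matroid flats only; the closure replaces an arbitrary [S] by a
    flat with the same intersection. *)
Definition closure alpha S : {set 'I_n} :=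
  [set i | (flat_space alpha S <= hyperplane (alpha i))%VS].

Lemma sub_closure alpha S : S \subset closure alpha S.
Proof. by apply/subsetP=> i iS; rewrite inE; apply: bigcapv_inf iS _. Qed.

Lemma flat_space_closure alpha S :
  flat_space alpha (closure alpha S) = flat_space alpha S.
Proof.
apply/eqP; rewrite eqEsubv; apply/andP; split; apply/subv_bigcapP => i iS.
  by apply: bigcapv_inf (subsetP (sub_closure alpha S) i iS) _.
by move: iS; rewrite inE.
Qed.

(* A point of the flat off the hyperplane of i detects the coefficient of i. *)
Lemma independent_setU1 alpha S (I : {set 'I_n}) i :
  I \in arr_matroid alpha -> I \subset closure alpha S ->
  i \notin closure alpha S -> i |: I \in arr_matroid alpha.
Proof.
move=> indI /subsetP sIS; rewrite inE => /subvPn[v /mem_flat_space vS viN].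
apply: contraLR indI => /arr_matroid_dependentP[c [c0 cI cR]].
apply/arr_matroid_dependentP; exists c; split=> // j jI.
case: (eqVneq j i) => [->|ji]; last by apply: cI; rewrite !inE negb_or ji.
have := cR; rewrite mem_relation_sum => /eqP/(congr1 (mulmx^~ v)).
rewrite mul0mx mulmx_suml (bigD1 i) //= big1 => [|h hi].
  rewrite addr0 -scalemxAl => /eqP; rewrite scaler_eq0 => /orP[/eqP //|].
  by rewrite -mem_hyperplane (negbTE viN).
case: (boolP (h \in I)) => hI; last first.
  by rewrite cI ?scale0r ?mul0mx // !inE negb_or hi.
have := sIS h hI; rewrite inE => /subvP/(_ v).
rewrite mem_hyperplane -scalemxAl => /(_ _)/eqP ->; rewrite ?scaler0 //.
exact/mem_flat_space.
Qed.

(** A largest independent subset of the closure stays independent when an outside element is added,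
    so the rank grows. *)
Lemma closure_flat alpha S : matroid_flat (arr_matroid alpha) (closure alpha S).
Proof.
move=> i iS; rewrite /matroid_rank.
(* The independent set [set0] ensures that the maximum is attained. *)
have ind0 : (set0 \in arr_matroid alpha) && (set0 \subset closure alpha S).
  rewrite sub0set andbT; apply: contraT => /arr_matroid_dependentP[c [c0 cS _]].
  by case/eqP: c0; apply/colP=> j; rewrite cS ?inE // mxE.
rewrite (bigmax_eq_arg set0 ind0).
case: arg_maxnP => // I /andP[indI sIS] _.
apply: (bigmax_sup (i |: I)).
  by rewrite (independent_setU1 indI sIS iS) setUS.
by rewrite cardsU1 (contra (subsetP sIS i) iS).
Qed.

(* A dependent set of at most k <= l.+1 elements spans a nonempty flat of rank
   less than k. *)
Lemma general_position_point k alpha a S c :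
  general_linear_position k alpha a -> (k <= l.+1)%N -> (#|S| <= k)%N ->
  c != 0 -> supported c S -> c \in relation_space alpha ->
  exists2 v : 'cV[K]_(l.+1), forall i, i \in S -> alpha i *m v = 0 & a *m v != 0.
Proof.
move=> gen kl Sk c0 cS cR.
have [j cj] := cV_neq0 c0.
have jS : j \in S by apply: contraNT cj => /cS ->.
(* As [c] is nonzero at [j], the form [alpha j] vanishes wherever the others of [S] do. Dropping [j]
   makes the codimension bound strict. *)
have flatD1 : flat_space alpha S = flat_space alpha (S :\ j).
  apply/vspaceP=> v; apply/mem_flat_space/mem_flat_space => vS i.
    by rewrite inE => /andP[_]; apply: vS.
  case: (eqVneq i j) => [-> _|ij iS]; last by apply: vS; rewrite !inE ij.
  have := cR; rewrite mem_relation_sum => /eqP/(congr1 (mulmx^~ v)).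
  rewrite mul0mx mulmx_suml (bigD1 j) //= big1 => [|h hj].
    rewrite addr0 -scalemxAl => /eqP; rewrite scaler_eq0 (negbTE cj).
    by move/eqP.
  rewrite -scalemxAl; case: (boolP (h \in S)) => hS.
    by rewrite vS ?scaler0 // !inE hj.
  by rewrite cS ?scale0r.
have codimS : (codim (flat_space alpha S) < k)%N.
  rewrite flatD1; apply: leq_trans Sk; rewrite (cardsD1 j S) jS.
  exact: codim_flat_space.
have flat0 : flat_space alpha S != 0%VS.
  apply: contraTneq codimS => ->.
  by rewrite /codim dimv0 subn0 -leqNgt.
have := gen _ (@closure_flat alpha S); rewrite flat_space_closure.
case/(_ flat0 (ltnW codimS))/subvPn => v /mem_flat_space vS vN.
by exists v => //; rewrite -mem_hyperplane.
Qed.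

(** * Weak perspective representations as orthogonality conditions *)

Lemma perspective_relation alpha a lam c :
  \sum_j c j 0 *: perspective alpha a lam j =
  \sum_j c j 0 *: alpha j + (lam^T *m c) 0 0 *: a.
Proof.
rewrite mxE scaler_suml -big_split; apply: eq_bigr => j _.
by rewrite /perspective scalerDr scalerA mxE mulrC.
Qed.

Lemma mx11_eq0 (A : 'M[K]_1) : (A == 0) = (A 0 0 == 0).
Proof.
apply/eqP/eqP => [->|A0]; first by rewrite mxE.
by rewrite [A]mx11_scalar A0 raddf0.
Qed.

Lemma weak_perspectiveP k alpha a lam :
  (k <= l.+1)%N -> general_linear_position k alpha a ->
  weak_perspective k alpha a lam <->
  forall c, c \in relation_space alpha -> (rel_length c <= k)%N ->
    lam^T *m c = 0.
Proof.
move=> kl gen; split; last first.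
  move=> orth; apply/weak_representationP => S Sk.
  case/arr_matroid_dependentP => c [c0 cS cR].
  apply/arr_matroid_dependentP; exists c; split=> //.
  rewrite mem_relation_sum perspective_relation orth ?mxE ?scale0r ?addr0.
  - by rewrite -mem_relation_sum.
  - by [].
  apply: leq_trans Sk; apply/subset_leq_card/subsetP => j; rewrite inE.
  by apply: contraNT => /cS ->.
move/weak_representationP => weak c cR ck.
have : supported c [set j | c j 0 != 0].
  by move=> j; rewrite inE negbK => /eqP.
(* Induction runs over sets [S] containing the support, since the reduction below only bounds the
   new support. *)
move: ck; rewrite /rel_length; move: [set j | _] => S.
have [m] := ubnP #|S|; elim: m S c cR => // m IHm S c cR ltSm Sk cS.
have [->|c0] := eqVneq c 0; first by rewrite mulmx0.
have [v vS va] := general_position_point gen kl Sk c0 cS cR.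
have /weak : S \notin arr_matroid alpha.
  by apply/arr_matroid_dependentP; exists c.
case/(_ Sk)/arr_matroid_dependentP => d [d0 dS].
rewrite mem_relation_sum perspective_relation => dR.
(* At [v] all forms of [S] vanish, which leaves [lam^T *m d] times the nonzero value of [a]. *)
have lamd : lam^T *m d = 0.
  apply/eqP; rewrite mx11_eq0; apply: contraNT va.
  move: dR => /eqP/(congr1 (mulmx^~ v)).
  rewrite mul0mx mulmxDl -scalemxAl mulmx_suml big1 ?add0r => [/eqP|j _].
    by rewrite scaler_eq0 => /orP[->|].
  rewrite -scalemxAl; case: (boolP (j \in S)) => [/vS ->|/dS ->].
    by rewrite scaler0.
  by rewrite scale0r.
move: dR; rewrite lamd mxE scale0r addr0 -mem_relation_sum => dR.
have [j dj] := cV_neq0 d0.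
have jS : j \in S by apply: contraNT dj => /dS ->.
(* This factor cancels the entry of [c] at [j], so [c - t *: d] is a relation supported on
   [S :\ j]. *)
pose t := c j 0 / d j 0.
have -> : c = (c - t *: d) + t *: d by rewrite subrK.
rewrite mulmxDr -scalemxAr lamd scaler0 addr0.
have cardS : #|S :\ j|.+1 = #|S| by rewrite (cardsD1 j S) jS.
apply: (IHm (S :\ j)).
- by rewrite memvB // memvZ.
- by rewrite cardS.
- by apply: leq_trans Sk; rewrite -cardS.
move=> i; rewrite !inE negb_and negbK !mxE => /orP[/eqP ->|iS].
  by rewrite divfK ?subrr.
by rewrite cS // dS // mulr0 subrr.
Qed.

(** * Trivial representations and generation by short relations *)

Lemma trivial_perspective_mulmx alpha v :
  \col_j (alpha j *m v) 0 0 = (coef_mx alpha)^T *m v.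
Proof.
by apply/colP=> j; rewrite !mxE; apply: eq_bigr => i _; rewrite !mxE.
Qed.

Lemma trivial_perspectiveP alpha lam :
  trivial_perspective alpha lam <->
  {in relation_space alpha, forall c, lam^T *m c = 0}.
Proof.
split=> [[v ->] c|orth].
  rewrite trivial_perspective_mulmx mem_relation => /eqP cR.
  by rewrite trmx_mul trmxK -mulmxA cR mulmx0.
have [c cR|v ->] := @row_space_dual _ _ _ (coef_mx alpha) lam.
  by apply: orth; rewrite mem_relation cR.
by exists v; rewrite trivial_perspective_mulmx.
Qed.

(* The relations of length at most k need not be finite in number; they are the
   union of the finitely many spaces [relations_on alpha S], #|S| <= k. *)
Lemma short_relations_generated k alpha :
  exists X : seq 'cV[K]_n,
    all [pred c | (c \in relation_space alpha) && (rel_length c <= k)%N] X /\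
    forall c, c \in relation_space alpha -> (rel_length c <= k)%N -> c \in <<X>>%VS.
Proof.
pose X := flatten [seq (vbasis (relations_on alpha A) : seq _)
                  | A <- enum [pred A : {set 'I_n} | (#|A| <= k)%N]].
exists X; split=> [|c cR ck].
  apply/allP => c /flatten_mapP[S]; rewrite mem_enum inE => Sk.
  move=> /vbasis_mem/relations_onP[cR cS]; rewrite /= cR.
  apply: leq_trans Sk; apply/subset_leq_card/subsetP => j; rewrite inE.
  by apply: contraNT => /cS ->.
pose S := [set j | c j 0 != 0].
have : c \in relations_on alpha S.
  by apply/relations_onP; split=> // j; rewrite inE negbK => /eqP.
rewrite -(span_basis (vbasisP (relations_on alpha S))); apply: subvP.
apply: sub_span => d dS; apply/flatten_mapP; exists S => //.
by rewrite mem_enum inE.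
Qed.

Lemma generated_perspectiveP k alpha a :
  (k <= l.+1)%N -> general_linear_position k alpha a ->
  generated k alpha <-> no_nontrivial_weak_perspective k alpha a.
Proof.
move=> kl gen; split=> [genk lam /(weak_perspectiveP _ kl gen) orth | triv u].
  apply/trivial_perspectiveP => c /genk[X /allP Xk].
  by apply: span_orthogonal => x /Xk/andP[]; apply: orth.
split=> [uR|[X /allP Xk]]; last first.
  by apply: subvP; apply/span_subvP => x /Xk/andP[].
have [X [Xk spanX]] := short_relations_generated k alpha; exists X => //.
(* A vector [lam] orthogonal to the short relations is a weak perspective representation, hence
   trivial, hence orthogonal to [u]. *)
apply: mem_span_dual => lam lamX.
suff /triv/trivial_perspectiveP : weak_perspective k alpha a lam by apply.
apply/(weak_perspectiveP _ kl gen) => c cR ck.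
exact: span_orthogonal lamX (spanX c cR ck).
Qed.

(** * Formality as 3-generation *)

Lemma hyperplaneZ b a : b != 0 -> hyperplane (b *: a) = hyperplane a.
Proof.
move=> b0; apply/vspaceP=> v.
by rewrite !mem_hyperplane -scalemxAl scaler_eq0 (negbTE b0).
Qed.

(** A single nonzero entry would make a form zero; exactly two would make two forms proportional, so
    that their hyperplanes coincide. *)
Lemma relation_length_ge3 alpha c :
  arrangement alpha -> c \in relation_space alpha -> c != 0 ->
  (3 <= rel_length c)%N.
Proof.
move=> [alpha0 injH] cR c0.
have [i ci] := cV_neq0 c0.
have := cR; rewrite mem_relation_sum (bigD1 i) //= => /eqP sum0.
have [j ji cj] : exists2 j, j != i & c j 0 != 0.
  apply/exists_inP; apply: contraNT (alpha0 i) => /exists_inPn cN0.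
  move: sum0; rewrite big1 ?addr0 => [/eqP|j /cN0]; last first.
    by rewrite negbK => /eqP ->; rewrite scale0r.
  by rewrite scaler_eq0 (negbTE ci).
rewrite /rel_length (cardsD1 i) (cardsD1 j) !inE ci ji cj !add1n !ltnS card_gt0.
apply: contra_neqN (ji) => /eqP A0; apply: injH => /=.
move: sum0; rewrite (bigD1 j) //= big1 ?addr0 => [sum0|h /andP[hi hj]]; last first.
  have := in_set0 h; rewrite -A0 !inE hi hj /= => /negbFE/eqP ->.
  by rewrite scale0r.
have /eqP := sum0; rewrite addr_eq0 -scaleNr => /eqP ciE.
by rewrite -(hyperplaneZ (alpha i) ci) ciE hyperplaneZ // oppr_eq0.
Qed.

(** Relations of length at most 3 have length exactly 3 or are zero, and zero vectors can be
    filtered out of a spanning list. *)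
Lemma formal_generated3 alpha :
  arrangement alpha -> formal alpha <-> generated 3 alpha.
Proof.
move=> arr; split=> spanR u; split.
- case/spanR=> X /allP X3 uX; exists X => //.
  by apply/allP=> x /X3/andP[xR /eqP x3]; rewrite /= xR x3.
- case=> X /allP X3; apply: subvP; apply/span_subvP => x /X3.
  by case/andP.
- case/spanR=> X /allP X3 uX; exists [seq x <- X | x != 0].
    apply/allP=> x; rewrite mem_filter => /andP[x0 /X3/andP[xR x3]].
    by rewrite /= xR eqn_leq x3 (relation_length_ge3 arr).
  move: uX; apply: subvP; apply/span_subvP => x xX.
  have [->|x0] := eqVneq x 0; first exact: mem0v.
  by apply: memv_span; rewrite mem_filter x0.
case=> X /allP X3; apply: subvP; apply/span_subvP => x /X3.
by case/andP.
Qed.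

End Arrangements.

Theorem corollary3p20 (K : fieldType) (charK0 : [pchar K] =i pred0)
    (l n : nat) (hl : (2 <= l)%N)
    (alpha : 'I_n -> 'rV[K]_(l.+1)) (hA : arrangement alpha) :
  (forall alpha0 : 'rV[K]_(l.+1), alpha0 != 0 ->
     general_linear_position 3 alpha alpha0 ->
     (formal alpha <-> no_nontrivial_weak_perspective 3 alpha alpha0)) /\
  (forall k : nat, (3 <= k <= l.+1)%N ->
     forall alpha0 : 'rV[K]_(l.+1), alpha0 != 0 ->
     general_linear_position k alpha alpha0 ->
     (generated k alpha <-> no_nontrivial_weak_perspective k alpha alpha0)).
Proof.
split=> [alpha0 _ gen|k /andP[_ kl] alpha0 _ gen]; last first.
  exact: generated_perspectiveP.
by apply: iff_trans (formal_generated3 hA) _; apply: generated_perspectiveP.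
Qed.
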